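(* Let $q$ be an odd prime power, $G=SL_2(\mathbb{F}_q)$, and let $F^k=F^kR(G)$, $k\ge 0$, be the tensor rank filtration of the representation ring $R(G)$. Then $F^2=R(G)$.
   Context: $\widehat{G}$ is the set of isomorphism classes of irreducible complex representations (irreps) of $G$, and $R(G)=\mathbb{Z}[\widehat G]$ is the representation ring (addition is direct sum, multiplication is tensor product). The four irreps of dimensions $\frac{q\pm1}{2}$: fix a non-trivial additive character $\psi$ of $\mathbb{F}_q$ and a non-square $\varepsilon\in\mathbb{F}_q$. For a non-trivial additive character $\chi$ of $\mathbb{F}_q$, the oscillator representation $\omega_\chi$ of $G$ on the space $L^2(\mathbb{F}_q)$ of complex functions on $\mathbb{F}_q$ is determined by: $\left[\omega_\chi\begin{pmatrix}1&a\\0&1\end{pmatrix}f\right](y)=\chi(\tfrac12 ay^2)f(y)$; $\left[\omega_\chi\begin{pmatrix}0&1\\-1&0\end{pmatrix}f\right](y)=\frac{1}{\gamma}\sum_{y'\in\mathbb{F}_q}\chi(yy')f(y')$ with $\gamma=\sum_{y}\chi(-\frac12y^2)$; $\left[\omega_\chi\begin{pmatrix}c^{-1}&0\\0&c\end{pmatrix}f\right](y)=\left(\frac{c}{q}\right)f(c^{-1}y)$, where $\left(\frac{\cdot}{q}\right)$ is the Legendre symbol (quadratic character) of $\mathbb{F}_q^*$. Put $\omega_{\psi+}=\omega_\psi$ and $\omega_{\psi-}=\omega_{\psi_\varepsilon}$, with $\psi_\varepsilon(z)=\psi(\varepsilon z)$. Each of $\omega_{\psi\pm}$ is the direct sum of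 two irreps (the even functions, of dimension $\frac{q+1}{2}$, and the odd functions, of dimension $\frac{q-1}{2}$); the resulting four irreps are ''the four irreps of $G$ of dimensions $\frac{q\pm1}{2}$''. Tensor rank filtration: $F^k$ is the set of elements of $R(G)$ that are integer combinations of irreps occurring as constituents of $\ell$-fold tensor products, $0\le\ell\le k$, of these four irreps (the $0$-fold tensor product being the trivial representation). *)

(* Defs.v *)
From mathcomp Require Import all_boot all_order all_algebra all_fingroup.
From mathcomp Require Import all_solvable all_field all_character.

Set Implicit Arguments.
Unset Strict Implicit.
Unset Printing Implicit Defensive.

Import Order.TTheory GRing.Theory Num.Theory.
Local Open Scope ring_scope.

(* Representations are matrix representations over algC acting on the left of *)
(* column vectors.  For G a finite group, Iirr G indexes the isomorphism      *)
(* classes of irreducible complex representations, 'Chi_i is a representative *)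
(* of the i-th class and 'chi_i its character.  The representation ring R(G)  *)
(* is the ring 'Z[irr G] of virtual characters, the class of 'Chi_i being     *)
(* identified with 'chi_i.                                                    *)

Section SpecialLinear.

Variable F : finFieldType.

Definition SL2_set : {set {'GL_2[F]}} := [set g | \det (GLval g) == 1].

Lemma SL2_group_set : group_set SL2_set.
Proof.
apply/group_setP; split=> [|g h]; first by rewrite inE GL_1E det1.
by rewrite !inE GL_MxE det_mulmx => /eqP-> /eqP->; rewrite mulr1.
Qed.

Definition SL2 : {group {'GL_2[F]}} := Group SL2_group_set.

Definition mx2 (a b c d : F) : 'M[F]_2 :=
  \matrix_(i, j) if i == 0 then (if j == 0 then a else b)
                 else (if j == 0 then c else d).

End SpecialLinear.

Section Oscillator.

Variable F : finFieldType.
Local Notation G := (SL2 F).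

Definition additive_character (chi : F -> algC) : Prop :=
  chi 0 = 1 /\ (forall x y, chi (x + y) = chi x * chi y).

Definition nontrivial_character (chi : F -> algC) : Prop :=
  exists x, chi x != 1.

Definition is_square (x : F) : bool := [exists y : F, x == y ^+ 2].

(* The quadratic character; only its values at c != 0 are used. *)
Definition legendre (c : F) : algC := if is_square c then 1 else -1.

Definition gauss_sum (chi : F -> algC) : algC :=
  \sum_(y : F) chi (- (2%:R^-1 * y ^+ 2)).

Definition fvec (f : F -> algC) : 'cV[algC]_#|F| := \col_i f (enum_val i).

Definition is_oscillator (chi : F -> algC)
    (W : mx_representation algC G #|F|) : Prop :=
  [/\ forall (g : {'GL_2[F]}) (a : F) (f : F -> algC),
        GLval g = mx2 1 a 0 1 ->
        W g *m fvec f = fvec (fun y => chi (2%:R^-1 * a * y ^+ 2) * f y),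
      forall (g : {'GL_2[F]}) (f : F -> algC),
        GLval g = mx2 0 1 (-1) 0 ->
        W g *m fvec f =
          fvec (fun y => (gauss_sum chi)^-1 * \sum_(y' : F) chi (y * y') * f y')
    & forall (g : {'GL_2[F]}) (c : F) (f : F -> algC),
        c != 0 -> GLval g = mx2 c^-1 0 0 c ->
        W g *m fvec f = fvec (fun y => legendre c * f (c^-1 * y))].

Definition even_function (f : F -> algC) : Prop := forall y, f (- y) = f y.
Definition odd_function (f : F -> algC) : Prop := forall y, f (- y) = - f y.

(* The set P of functions is a subspace stable under W, and rho is the matrix *)
(* of the action of W on P in the basis given by the columns of B             *)
(* (row_full B says that these columns are linearly independent).             *)
Definition acts_on_as (W : mx_representation algC G #|F|)
    (P : (F -> algC) -> Prop) (n : nat)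
    (rho : mx_representation algC G n) : Prop :=
  exists B : 'M[algC]_(#|F|, n),
    [/\ row_full B,
        forall f, P f <-> exists c : 'cV[algC]_n, fvec f = B *m c
      & forall g, g \in G -> W g *m B = B *m rho g].

Definition oscillator_irrep (chi : F -> algC) (i : Iirr G) : Prop :=
  exists W : mx_representation algC G #|F|,
    is_oscillator chi W /\
    (acts_on_as W even_function 'Chi_i \/ acts_on_as W odd_function 'Chi_i).

(* The four irreps of dimensions (q + 1) / 2 and (q - 1) / 2, q = #|F|. *)
Definition four_irreps (psi : F -> algC) (eps : F) (i : Iirr G) : Prop :=
  oscillator_irrep psi i \/ oscillator_irrep (fun z => psi (eps * z)) i.

End Oscillator.

Section TensorRank.

Variables (gT : finGroupType) (G : {group gT}).

Lemma triv_mx_repr : mx_repr G (fun _ : gT => 1%:M : 'M[algC]_1).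
Proof. by split=> // g h _ _; rewrite mulmx1. Qed.

Definition triv_repr : representation algC G :=
  Representation (MxRepresentation triv_mx_repr).

Fixpoint tensor_product (s : seq (Iirr G)) : representation algC G :=
  if s is i :: s' then Representation (prod_repr 'Chi_i (tensor_product s'))
  else triv_repr.

Definition occurs_in_rank (S : Iirr G -> Prop) (k : nat) (j : Iirr G) : Prop :=
  exists s : seq (Iirr G),
    [/\ (size s <= k)%N, forall i, i \in s -> S i
      & j \in irr_constt (cfRepr (tensor_product s))].

Definition tensor_rank_filtration (S : Iirr G -> Prop) (k : nat)
    (phi : 'CF(G)) : Prop :=
  exists z : Iirr G -> int,
    (forall j, z j != 0 -> occurs_in_rank S k j) /\
    phi = \sum_j (z j)%:~R *: 'chi_j.

End TensorRank.

(* Main.v *)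
Require Import Defs.
From mathcomp Require Import all_boot all_order all_algebra all_fingroup.
From mathcomp Require Import all_solvable all_field all_character.
From mathcomp Require Import ring zify.

Set Implicit Arguments.
Unset Strict Implicit.
Unset Printing Implicit Defensive.

Import Order.TTheory GRing.Theory Num.Theory.
Local Open Scope ring_scope.

(* Let q = #|F| and let U be the set of the q ^ 2 elements of SL2 F of trace *)
(* 2, with indicator function [U].  The character omega_chi of the oscillator *)
(* representation is q at 1, a sign s(g) times the Gauss sum of chi at the    *)
(* other g of trace 2, and legendre (tr g - 2) elsewhere; s(g) does not       *)
(* depend on chi.  Hence '[omega_chi] = 2, so the even and odd parts are      *)
(* irreducible, and since the Gauss sums of psi and psi_eps are opposite,     *)
(*   omega_psi * (omega_psi + omega_psi_eps) = 2 (1 + q ^ 2 [g = 1] - [U]).   *)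
(* If this character were orthogonal to chi_j, then                           *)
(*   \sum_(g in U) (chi_j g)^* = #|G| [j = 0] + q ^ 2 chi_j 1,                *)
(* which by |chi_j g| <= chi_j 1 forces j != 0 and U \subset cfker chi_j;     *)
(* but U generates SL2 F, so that j = 0, a contradiction.                     *)

(** * The quadratic character and Gauss sums *)

(** The oscillator representation is built explicitly: [weil_kernelM] shows that the kernels of the
    operators multiply like the matrices, Gauss sums accounting for all constants, and
    [weil_kernel_trace] gives its character. A norm estimate ([cfnorm_weil]) then splits that
    character into exactly two irreducibles, the even and the odd part ([weil_char_parity]).

    Every irrep is a constituent of omega_psi * (omega_psi + omega_psi_eps), by [weil_tensor_char]
    and [weil_tensor_constt]: failing to occur would force an irrep to be trivial on all elements of
    trace 2, which generate the group ([SL2_sub_group]), and the trivial irrep does occur. Expanding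
    this product into products of two of the four irreps puts every irrep in rank 2, and the irreps
    span R(G). *)

Section FiniteField.

Variable F : finFieldType.

Lemma odd_card_two_neq0 : odd #|F| -> 2%:R != 0 :> F.
Proof.
move=> oddF; apply/eqP=> two0.
have d2 : (#[1%R : F]%g %| 2)%N.
  by rewrite order_dvdn FinRing.zmodXgE two0.
have dF : (#[1%R : F]%g %| #|F|)%N.
  by rewrite -cardsT; apply: order_dvdG; rewrite inE.
have: (#[1%R : F]%g %| gcdn 2 #|F|)%N by rewrite dvdn_gcd d2 dF.
have /eqP -> : coprime 2 #|F| by rewrite coprime2n.
by rewrite dvdn1 order_eq1 oner_eq0.
Qed.

(** Here (x - 1)^2 = 1 - x * y = 0. It is applied to the diagonal of a triangular matrix of
    determinant 1 and trace 2. *)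
Lemma mul1_add2 (x y : F) : x * y = 1 -> x + y = 2%:R -> x = 1 /\ y = 1.
Proof.
move=> xy1 xDy; have yE : y = 2%:R - x by rewrite -xDy addrC addKr.
have /eqP : (x - 1) ^+ 2 = 0.
  by transitivity (1 - x * y); [rewrite yE; ring | rewrite xy1 subrr].
by rewrite expf_eq0 subr_eq0 /= yE => /eqP->; rewrite mulr2n addrK.
Qed.

Lemma nonzero_powers : exists g : F, forall a, a != 0 -> exists n, a = g ^+ n.
Proof.
have /cyclicP[g defU] := field_unit_group_cyclic [group of [set: {unit F}]].
exists (FinRing.uval g) => a nz_a.
have Ua : a \is a GRing.unit by rewrite unitfE.
have: FinRing.Unit Ua \in <[g]>%g by rewrite -defU inE.
case/cycleP=> n def_a; exists n.
by rewrite -FinRing.val_unitX -def_a.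
Qed.

Lemma is_square_sqr (s : F) : is_square (s ^+ 2).
Proof. by apply/existsP; exists s. Qed.

Lemma nonsquare_neq0 (a : F) : ~~ is_square a -> a != 0.
Proof.
apply: contraNneq => ->.
by rewrite -[X in is_square X](expr0n _ 2) is_square_sqr.
Qed.

Lemma is_squareM_sqr (a s : F) : s != 0 -> is_square (a * s ^+ 2) = is_square a.
Proof.
move=> nz_s; apply/existsP/existsP=> [] [y /eqP y2].
  by exists (y / s); rewrite expr_div_n -y2 mulfK ?expf_neq0.
by exists (y * s); rewrite y2 exprMn.
Qed.

(** Nonsquares are odd powers of a generator of the cyclic group of units, and a sum of two odd
    exponents is even. *)
Lemma nonsquareM (a b : F) :
  ~~ is_square a -> ~~ is_square b -> is_square (a * b).
Proof.
have [g gP] := nonzero_powers.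
have odd_log x : ~~ is_square x -> exists k, x = g ^+ k.*2.+1.
  move=> nsq_x; have [n xE] := gP x (nonsquare_neq0 nsq_x); move: nsq_x.
  rewrite xE -(odd_double_half n).
  case: (odd n) => [_ | ]; first by exists n./2.
  by rewrite add0n -muln2 exprM is_square_sqr.
move=> /odd_log[k ->] /odd_log[m ->]; rewrite -exprD.
by rewrite addSn addnS -doubleD -doubleS -muln2 exprM is_square_sqr.
Qed.

Lemma legendre_sqr (s : F) : legendre (s ^+ 2) = 1.
Proof. by rewrite /legendre is_square_sqr. Qed.

(** Both factors must be nonzero: 0 counts as a square, so [legendre 0] is 1. *)
Lemma legendreM (a b : F) :
  a != 0 -> b != 0 -> legendre (a * b) = legendre a * legendre b.
Proof.
move=> nz_a nz_b; rewrite /legendre.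
have [/existsP[s /eqP def_a] | nsq_a] := boolP (is_square a).
  have nz_s : s != 0 by apply: contraNneq nz_a => s0; rewrite def_a s0 expr0n.
  by rewrite mul1r def_a mulrC is_squareM_sqr.
have [/existsP[s /eqP def_b] | nsq_b] := boolP (is_square b).
  have nz_s : s != 0 by apply: contraNneq nz_b => s0; rewrite def_b s0 expr0n.
  by rewrite mulr1 def_b is_squareM_sqr // (negPf nsq_a).
by rewrite nonsquareM // mulrNN mulr1.
Qed.

Lemma legendreK (a : F) : legendre a * legendre a = 1.
Proof. by rewrite /legendre; case: ifP; rewrite ?mulrNN mulr1. Qed.

Lemma legendreV (a : F) : legendre a^-1 = legendre a.
Proof.
have [-> | nz_a] := eqVneq a 0; first by rewrite invr0.
have {1}-> : a^-1 = a * a^-1 ^+ 2 by rewrite expr2 mulrA mulfV ?mul1r.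
by rewrite /legendre is_squareM_sqr ?invr_eq0.
Qed.

Lemma legendre1 : legendre (1 : F) = 1.
Proof. by rewrite -[X in legendre X](expr1n _ 2) legendre_sqr. Qed.

Lemma conj_legendre (a : F) : (legendre a)^* = legendre a.
Proof. by rewrite /legendre; case: ifP; rewrite ?rmorphN rmorph1. Qed.

End FiniteField.

Section AdditiveCharacter.

Variables (F : finFieldType) (chi : F -> algC).
Hypothesis chi_char : additive_character chi.

Lemma additive_char0 : chi 0 = 1.
Proof. by case: chi_char. Qed.

Lemma additive_charD x y : chi (x + y) = chi x * chi y.
Proof. by case: chi_char. Qed.

Lemma additive_charMn x n : chi (x *+ n) = chi x ^+ n.
Proof.
elim: n => [|n IHn]; first by rewrite mulr0n additive_char0.
by rewrite mulrS additive_charD IHn exprS.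
Qed.

(** Since #|F| times x is 0, [chi x] is a root of unity. *)
Lemma additive_char_norm x : `|chi x| = 1.
Proof.
have q_gt0 : (0 < #|F|)%N by apply/card_gt0P; exists 0.
apply/eqP; rewrite -(pexpr_eq1 q_gt0) // -normrX -additive_charMn.
have -> : x *+ #|F| = 0.
  by rewrite -FinRing.zmodXgE -cardsT; apply: expg_cardG; rewrite inE.
by rewrite additive_char0 normr1.
Qed.

Lemma additive_charN x : chi (- x) = (chi x)^*.
Proof.
have nz : chi x != 0 by rewrite -normr_gt0 additive_char_norm.
apply: (mulfI nz); rewrite -additive_charD subrr additive_char0.
by rewrite -normCK additive_char_norm expr1n.
Qed.

Lemma additive_charZ e : additive_character (fun z => chi (e * z)).
Proof.
by split=> [|x y]; rewrite ?mulr0 ?mulrDr ?additive_char0 ?additive_charD.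
Qed.

End AdditiveCharacter.

Lemma nontrivial_charZ (F : finFieldType) (chi : F -> algC) e :
  e != 0 -> nontrivial_character chi ->
  nontrivial_character (fun z => chi (e * z)).
Proof. by move=> nz_e [x chi_x]; exists (e^-1 * x); rewrite mulVKf. Qed.

Definition quadratic_sum (F : finFieldType) (chi : F -> algC) (a : F) : algC :=
  \sum_(y : F) chi (a * y ^+ 2).

Section GaussSums.

Variables (F : finFieldType) (chi : F -> algC).
Hypotheses (F_odd : odd #|F|) (chi_char : additive_character chi).
Hypothesis chi_nontriv : nontrivial_character chi.

Let chi0 := additive_char0 chi_char.
Let chiD := additive_charD chi_char.
Let two_neq0 := odd_card_two_neq0 F_odd.

Lemma sum_additive_char a :
  \sum_(y : F) chi (a * y) = if a == 0 then #|F|%:R else 0.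
Proof.
case: eqP => [-> | /eqP nz_a].
  by under eq_bigr do rewrite mul0r chi0; rewrite sumr_const.
have [x chi_x] := chi_nontriv.
(* Translating y by a^-1 * x multiplies the sum by [chi x], which is not 1. *)
set S := \sum_y _; have: chi x * S = S.
  rewrite mulr_sumr
    [RHS](reindex_onto (fun y => y + a^-1 * x) (fun y => y - a^-1 * x)) /=.
    apply: eq_big => [y|y _]; first by rewrite addrK eqxx.
    by rewrite -chiD mulrDr mulVKf // addrC.
  by move=> y _; rewrite subrK.
move/eqP; rewrite -subr_eq0 -{2}[S]mul1r -mulrBl mulf_eq0 subr_eq0.
by rewrite (negPf chi_x) => /eqP.
Qed.

Lemma quadratic_sumM_sqr a s :
  s != 0 -> quadratic_sum chi (a * s ^+ 2) = quadratic_sum chi a.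
Proof.
move=> nz_s; rewrite /quadratic_sum.
rewrite [RHS](reindex_onto (fun y => s * y) (fun y => s^-1 * y)) /=.
  apply: eq_big => [y|y _]; first by rewrite mulKf ?eqxx.
  by congr chi; ring.
by move=> y _; rewrite mulVKf.
Qed.

(** After exchanging the sums, y = 0 contributes q - 1, and each of the q - 1 other y contributes -1
    by orthogonality. *)
Lemma sum_quadratic_sum : \sum_(b : F | b != 0) quadratic_sum chi b = 0.
Proof.
rewrite exchange_big /= (bigD1 0) //=.
under eq_bigr do rewrite expr0n mulr0 chi0.
rewrite sumr_const.
under eq_bigr => y nz_y.
  have: \sum_b chi (y ^+ 2 * b) = 0.
    by rewrite sum_additive_char expf_eq0 (negPf nz_y).
  rewrite (bigD1 0) //= mulr0 chi0 => /eqP; rewrite addrC addr_eq0 => /eqP sumE.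
  under eq_bigr do rewrite mulrC.
  rewrite sumE; over.
rewrite sumr_const; apply/eqP; rewrite mulNrn subr_eq0; apply/eqP.
by congr (_ *+ _).
Qed.

(* Replacing b by a * b permutes the nonzero elements, and for a nonsquare a  *)
(* one of b and a * b is a square, so that summing over b gives               *)
(* (q - 1) * (quadratic_sum chi 1 + quadratic_sum chi a) = 0.                 *)
Lemma quadratic_sum_nonsquare a :
  ~~ is_square a -> quadratic_sum chi a = - quadratic_sum chi 1.
Proof.
move=> nsq_a; have nz_a := nonsquare_neq0 nsq_a.
have sum0 :
    \sum_(b : F | b != 0) (quadratic_sum chi b + quadratic_sum chi (a * b)) = 0.
  rewrite big_split /= sum_quadratic_sum add0r -[RHS]sum_quadratic_sum.
  rewrite [RHS](reindex_onto (fun y => a * y) (fun y => a^-1 * y)) /=.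
    by apply: eq_bigl => y; rewrite mulKf // eqxx andbT mulf_eq0 negb_or nz_a.
  by move=> y _; rewrite mulVKf.
have sq b : is_square b -> b != 0 ->
    quadratic_sum chi b = quadratic_sum chi 1
    /\ quadratic_sum chi (a * b) = quadratic_sum chi a.
  case/existsP=> s /eqP-> ; rewrite expf_eq0 /= => nz_s.
  by rewrite -{1}[s ^+ 2]mul1r !quadratic_sumM_sqr.
apply/eqP; rewrite -addr_eq0; apply/eqP.
move: sum0; under eq_bigr => b nz_b.
  have -> : quadratic_sum chi b + quadratic_sum chi (a * b)
      = quadratic_sum chi a + quadratic_sum chi 1.
    have [sq_b | nsq_b] := boolP (is_square b).
      by have [-> ->] := sq b sq_b nz_b; rewrite addrC.
    have [-> _] := sq _ (nonsquareM nsq_a nsq_b) (mulf_neq0 nz_a nz_b).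
    congr (_ + _).
    have [t /eqP abE] := existsP (nonsquareM nsq_a nsq_b).
    have -> : b = a * (t / a) ^+ 2 by rewrite expr_div_n -abE; field.
    rewrite quadratic_sumM_sqr // mulf_neq0 ?invr_eq0 //.
    apply: contraTneq (mulf_neq0 nz_a nz_b) => t0.
    by rewrite abE t0 expr0n eqxx.
  over.
rewrite sumr_const => /eqP; rewrite mulrn_eq0 => /orP[|/eqP//].
by move/eqP/card0_eq/(_ 1); rewrite unfold_in /= oner_eq0.
Qed.

Lemma quadratic_sum_legendre a :
  a != 0 -> quadratic_sum chi a = legendre a * quadratic_sum chi 1.
Proof.
move=> nz_a; rewrite /legendre.
case: ifPn => [/existsP[s /eqP def_a] | /quadratic_sum_nonsquare->]; last first.
  by rewrite mulN1r.
rewrite mul1r def_a -[s ^+ 2]mul1r quadratic_sumM_sqr //.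
by apply: contraNneq nz_a => s0; rewrite def_a s0 expr0n.
Qed.

Lemma quadratic_sumM a b : a != 0 -> b != 0 ->
  quadratic_sum chi (a * b) = legendre a * quadratic_sum chi b.
Proof.
move=> nz_a nz_b; rewrite quadratic_sum_legendre ?mulf_neq0 // legendreM //.
by rewrite -mulrA -quadratic_sum_legendre.
Qed.

(** The substitution x = u + y turns a * (x^2 - y^2) into a * u^2 + 2 * a * u * y; summing over y
    leaves only u = 0. *)
Lemma quadratic_sum_mulN a : a != 0 ->
  quadratic_sum chi a * quadratic_sum chi (- a) = #|F|%:R.
Proof.
move=> nz_a; rewrite mulr_suml.
transitivity
  (\sum_(u : F) \sum_(y : F) chi (a * u ^+ 2) * chi (2%:R * a * u * y)).
  rewrite [RHS]exchange_big /=.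
  transitivity (\sum_(y : F) \sum_(x : F) chi (a * x ^+ 2 - a * y ^+ 2)).
    rewrite exchange_big /=; apply: eq_bigr => x _; rewrite mulr_sumr.
    by apply: eq_bigr => y _; rewrite chiD mulNr.
  apply: eq_bigr => y _.
  rewrite (reindex_onto (fun u => u + y) (fun x => x - y)) /=.
    apply: eq_big => [u|u _]; first by rewrite addrK eqxx.
    by rewrite -chiD; congr chi; ring.
  by move=> x _; rewrite subrK.
rewrite (bigD1 0) //= [X in _ + X]big1 => [|u nz_u].
  under eq_bigr do rewrite expr0n /= !mulr0 mul0r chi0 mulr1.
  by rewrite addr0 sumr_const.
rewrite -mulr_sumr sum_additive_char.
by rewrite !mulf_eq0 (negPf two_neq0) (negPf nz_a) (negPf nz_u) mulr0.
Qed.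

End GaussSums.

(** * The oscillator representation *)

Section WeilKernel.

Variables (F : finFieldType) (chi : F -> algC).
Hypotheses (F_odd : odd #|F|) (chi_char : additive_character chi).
Hypothesis chi_nontriv : nontrivial_character chi.

Let chi0 := additive_char0 chi_char.
Let chiD := additive_charD chi_char.
Let two_neq0 : 2%:R != 0 :> F := odd_card_two_neq0 F_odd.
Local Notation gamma := (gauss_sum chi).

Lemma gauss_sumE : gamma = quadratic_sum chi (- 2%:R^-1).
Proof. by apply: eq_bigr => y _; rewrite mulNr. Qed.

Lemma quadratic_sum_gauss a :
  a != 0 -> quadratic_sum chi a = legendre (- (2%:R * a)) * gamma.
Proof.
move=> nz_a; have aE : (- (2%:R * a)) * - 2%:R^-1 = a.
  by rewrite mulrNN mulrAC mulfV ?mul1r.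
by rewrite -{1}aE quadratic_sumM ?oppr_eq0 ?mulf_neq0 ?invr_eq0 // -gauss_sumE.
Qed.

(** This is [quadratic_sum_mulN] at -1/2, where the sum at 1/2 is [legendre (-1)] times gamma. *)
Lemma sqr_gauss_sum : gamma ^+ 2 = legendre (-1 : F) * #|F|%:R.
Proof.
have nz_h : - 2%:R^-1 != 0 :> F by rewrite oppr_eq0 invr_eq0.
rewrite -(quadratic_sum_mulN F_odd chi_char chi_nontriv nz_h) -gauss_sumE opprK.
rewrite quadratic_sum_gauss ?invr_eq0 // mulfV //.
by rewrite [gamma * _]mulrCA !mulrA legendreK mul1r.
Qed.

Lemma gauss_sum_neq0 : gamma != 0.
Proof.
have: gamma ^+ 2 != 0.
  rewrite sqr_gauss_sum mulf_neq0 //.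
    by rewrite /legendre; case: ifP; rewrite ?oppr_eq0 oner_neq0.
  by rewrite pnatr_eq0 -lt0n; apply/card_gt0P; exists 0.
by rewrite expf_eq0.
Qed.

Lemma gauss_sum_norm : gamma * gamma^* = #|F|%:R.
Proof.
have nz_h : - 2%:R^-1 != 0 :> F by rewrite oppr_eq0 invr_eq0.
rewrite -(quadratic_sum_mulN F_odd chi_char chi_nontriv nz_h) -gauss_sumE.
suff -> : gamma^* = quadratic_sum chi (- - 2%:R^-1) by [].
rewrite gauss_sumE rmorph_sum; apply: eq_bigr => y _ /=.
by rewrite -(additive_charN chi_char) -mulNr.
Qed.

(** This sign makes the two oscillator characters cancel at the nontrivial elements of trace 2. *)
Lemma gauss_sumZ_nonsquare e :
  ~~ is_square e -> gauss_sum (fun z => chi (e * z)) = - gamma.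
Proof.
move=> nsq_e; have nz_e := nonsquare_neq0 nsq_e.
have -> : gauss_sum (fun z => chi (e * z)) = quadratic_sum chi (e * - 2%:R^-1).
  by apply: eq_bigr => y _; rewrite -mulrA mulNr.
rewrite quadratic_sumM ?oppr_eq0 ?invr_eq0 // -gauss_sumE /legendre (negPf nsq_e).
by rewrite mulN1r.
Qed.

Lemma sum_delta (f : F -> algC) t : \sum_z f z * (z == t)%:R = f t.
Proof.
rewrite (bigD1 t) //= eqxx mulr1 big1 ?addr0 // => z /negPf->.
by rewrite mulr0.
Qed.

(** Complete the square if a is nonzero; otherwise this is orthogonality. *)
Lemma sum_quadratic_char a b e :
  \sum_z chi (a * z ^+ 2 + b * z + e) =
    if a == 0 then chi e * (if b == 0 then #|F|%:R else 0)
    else legendre (- (2%:R * a)) * gamma * chi (e - b ^+ 2 / (4%:R * a)).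
Proof.
case: eqP => [-> | /eqP nz_a].
  rewrite -(sum_additive_char chi_char chi_nontriv) mulr_sumr.
  by apply: eq_bigr => z _; rewrite mul0r add0r chiD mulrC.
rewrite -quadratic_sum_gauss // mulr_suml.
rewrite (reindex_onto (fun z => z - b / (2%:R * a))
                      (fun z => z + b / (2%:R * a))) /=.
  apply: eq_big => [z|z _]; first by rewrite subrK eqxx.
  rewrite -chiD; congr chi; field.
  have -> : 4%:R = 2%:R ^+ 2 :> F by ring.
  by rewrite expf_eq0 nz_a two_neq0.
by move=> z _; rewrite addrK.
Qed.

(* The first case is the action of an upper triangular matrix; the second one *)
(* is computed from the Bruhat decomposition                                  *)
(* [a, b; c, d] = [1, a/c; 0, 1] * [-1/c, 0; 0, -c] * [0, 1; -1, 0]           *)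
(*                * [1, d/c; 0, 1].                                           *)
Definition weil_kernel (a b c d x y : F) : algC :=
  if c == 0 then legendre a * chi (2%:R^-1 * (a * b) * x ^+ 2) * (y == a * x)%:R
  else legendre (- c) / gamma
       * chi ((a * x ^+ 2 - 2%:R * x * y + d * y ^+ 2) / (2%:R * c)).

(** If one factor is upper triangular, its kernel is supported on a line and the sum collapses.
    Otherwise the exponent is a quadratic polynomial in z, summed by [sum_quadratic_char]; the
    powers of gamma and the Legendre symbols match exactly, so the representation is linear and not
    merely projective. *)
Lemma weil_kernelM (a1 b1 c1 d1 a2 b2 c2 d2 x y : F) :
  a1 * d1 - b1 * c1 = 1 -> a2 * d2 - b2 * c2 = 1 ->
  \sum_z weil_kernel a1 b1 c1 d1 x z * weil_kernel a2 b2 c2 d2 z y =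
    weil_kernel (a1 * a2 + b1 * c2) (a1 * b2 + b1 * d2)
                (c1 * a2 + d1 * c2) (c1 * b2 + d1 * d2) x y.
Proof.
have four_neq0 : 4%:R != 0 :> F.
  have -> : 4%:R = 2%:R ^+ 2 :> F by ring.
  by rewrite expf_eq0.
move=> det1 det2; rewrite /weil_kernel.
have [c10 | nz_c1] := eqVneq c1 0; have [c20 | nz_c2] := eqVneq c2 0.
- move: det1 det2; rewrite c10 c20 !(mulr0, mul0r, subr0, addr0) eqxx => det1 det2.
  have nz_a1 : a1 != 0.
    by apply/eqP=> a0; move/eqP: det1; rewrite a0 mul0r eq_sym oner_eq0.
  have nz_a2 : a2 != 0.
    by apply/eqP=> a0; move/eqP: det2; rewrite a0 mul0r eq_sym oner_eq0.
  under eq_bigr do rewrite mulrAC.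
  rewrite sum_delta legendreM //.
  have -> : d2 = a2^-1 by apply: (mulfI nz_a2); rewrite det2 mulfV.
  have -> : chi (2%:R^-1 * (a1 * a2 * (a1 * b2 + b1 / a2)) * x ^+ 2)
      = chi (2%:R^-1 * (a1 * b1) * x ^+ 2)
        * chi (2%:R^-1 * (a2 * b2) * (a1 * x) ^+ 2).
    by rewrite -chiD; congr chi; field; rewrite two_neq0 nz_a2.
  by rewrite mulrA [a2 * a1]mulrC; ring.
- move: det1 nz_c2; rewrite c10 !(mulr0, mul0r, subr0, add0r) => det1 nz_c2.
  have nz_a1 : a1 != 0.
    by apply/eqP=> a0; move/eqP: det1; rewrite a0 mul0r eq_sym oner_eq0.
  have -> : d1 = a1^-1 by apply: (mulfI nz_a1); rewrite det1 mulfV.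
  rewrite mulf_eq0 invr_eq0 (negPf nz_a1) (negPf nz_c2) /=.
  under eq_bigr do rewrite mulrAC.
  rewrite sum_delta -[- (a1^-1 * c2)]mulrN.
  rewrite legendreM ?invr_eq0 ?oppr_eq0 // legendreV.
  have -> : chi (((a1 * a2 + b1 * c2) * x ^+ 2 - 2%:R * x * y
                    + a1^-1 * d2 * y ^+ 2)
                 / (2%:R * (a1^-1 * c2)))
      = chi (2%:R^-1 * (a1 * b1) * x ^+ 2)
        * chi ((a2 * (a1 * x) ^+ 2 - 2%:R * (a1 * x) * y + d2 * y ^+ 2)
               / (2%:R * c2)).
    by rewrite -chiD; congr chi; field; rewrite ?two_neq0 ?nz_c2 ?nz_a1.
  by ring.
- move: det2; rewrite c20 !(mulr0, subr0, addr0) => det2.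
  have nz_a2 : a2 != 0.
    by apply/eqP=> a0; move/eqP: det2; rewrite a0 mul0r eq_sym oner_eq0.
  have -> : d2 = a2^-1 by apply: (mulfI nz_a2); rewrite det2 mulfV.
  rewrite mulf_eq0 (negPf nz_a2) (negPf nz_c1) /=.
  have deltaE z : (y == a2 * z) = (z == y / a2).
    by rewrite -[RHS](inj_eq (mulfI nz_a2)) [a2 * (y / a2)]mulrC mulfVK // eq_sym.
  under eq_bigr do rewrite deltaE mulrA.
  rewrite sum_delta -[- (c1 * a2)]mulNr legendreM ?oppr_eq0 //.
  have -> : chi ((a1 * a2 * x ^+ 2 - 2%:R * x * y
                  + (c1 * b2 + d1 / a2) * y ^+ 2)
                 / (2%:R * (c1 * a2)))
      = chi ((a1 * x ^+ 2 - 2%:R * x * (y / a2) + d1 * (y / a2) ^+ 2)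
             / (2%:R * c1))
        * chi (2%:R^-1 * (a2 * b2) * (y / a2) ^+ 2).
    by rewrite -chiD; congr chi; field; rewrite ?two_neq0 ?nz_a2 ?nz_c1.
  by ring.
(* Both factors lie in the big cell. The leading coefficient in z is c3 / (2 * c1 * c2), so the
   product is upper triangular exactly when the quadratic term vanishes. *)
set c3 := c1 * a2 + d1 * c2.
have b1E : b1 = (a1 * d1 - 1) / c1.
  by apply: (mulIf nz_c1); rewrite mulfVK // -det1; ring.
have b2E : b2 = (a2 * d2 - 1) / c2.
  by apply: (mulIf nz_c2); rewrite mulfVK // -det2; ring.
pose A := c3 / (2%:R * c1 * c2); pose B := - (x / c1 + y / c2).
pose E := a1 * x ^+ 2 / (2%:R * c1) + d2 * y ^+ 2 / (2%:R * c2).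
have integrandE z :
    legendre (- c1) / gamma
      * chi ((a1 * x ^+ 2 - 2%:R * x * z + d1 * z ^+ 2) / (2%:R * c1))
    * (legendre (- c2) / gamma
      * chi ((a2 * z ^+ 2 - 2%:R * z * y + d2 * y ^+ 2) / (2%:R * c2)))
  = legendre (- c1) / gamma * (legendre (- c2) / gamma)
    * chi (A * z ^+ 2 + B * z + E).
  rewrite mulrACA -chiD; congr (_ * chi _); rewrite /A /B /E /c3.
  by field; rewrite ?two_neq0 ?nz_c1 ?nz_c2.
under eq_bigr do rewrite integrandE.
rewrite -mulr_sumr sum_quadratic_char.
have nz_g := gauss_sum_neq0.
have [c30 | nz_c3] := eqVneq c3 0.
  have -> : A == 0 by rewrite /A c30 mul0r.
  have a2E : a2 = - (d1 * c2) / c1.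
    apply: (mulIf nz_c1); rewrite mulfVK // mulrC; apply/eqP.
    by rewrite -addr_eq0 -/c3 c30.
  have a3E : a1 * a2 + b1 * c2 = - c2 / c1.
    by rewrite a2E b1E; field.
  have -> : (B == 0) = (y == - c2 / c1 * x).
    rewrite oppr_eq0 addrC addr_eq0 -(inj_eq (mulIf nz_c2)) mulfVK //.
    by congr (y == _); field.
  rewrite a3E; case: (eqVneq y) => [yE | _]; last by rewrite !mulr0.
  rewrite mulr1 mulrCA [LHS]mulrC; congr (_ * chi _); last first.
    rewrite /E yE b1E b2E a2E; field.
    by rewrite ?two_neq0 ?nz_c1 ?nz_c2.
  rewrite legendreM ?oppr_eq0 ?invr_eq0 // legendreV.
  have -> : legendre (- c1) = legendre (-1 : F) * legendre c1.
    by rewrite -legendreM ?oppr_eq0 ?oner_neq0 // mulN1r.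
  rewrite mulrACA -invfM -expr2 sqr_gauss_sum.
  have nz_q : #|F|%:R != 0 :> algC.
    by rewrite pnatr_eq0 -lt0n; apply/card_gt0P; exists 0.
  have nz_l : legendre (-1 : F) != 0.
    by rewrite /legendre; case: ifP; rewrite ?oppr_eq0 oner_neq0.
  by field; rewrite nz_q nz_l.
have nz_A : A != 0 by rewrite !mulf_neq0 ?invr_eq0 ?mulf_neq0.
rewrite (negPf nz_A).
(* The factors are chosen so that the Legendre symbols cancel in pairs and only that of - c3
   remains. *)
have -> : - (2%:R * A) = - c1 * (- c2)^-1 * - c3 * (c1^-1) ^+ 2.
  by rewrite /A; field; rewrite oppr_eq0 two_neq0 nz_c1 nz_c2.
have -> : E - B ^+ 2 / (4%:R * A) =
    ((a1 * a2 + b1 * c2) * x ^+ 2 - 2%:R * x * y + (c1 * b2 + d1 * d2) * y ^+ 2)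
    / (2%:R * c3).
  rewrite /E /B /A /c3 b1E b2E; field.
  by rewrite ?two_neq0 ?four_neq0 ?nz_c1 ?nz_c2 ?nz_c3.
rewrite !mulrA; congr (_ * _).
rewrite !legendreM ?mulf_neq0 ?expf_neq0 ?invr_eq0 ?oppr_eq0 // !legendreV.
transitivity (legendre (- c1) * legendre (- c1)
  * (legendre (- c2) * legendre (- c2))
  * (legendre c1 * legendre c1) * (legendre (- c3) / gamma)).
  by field.
by rewrite !legendreK !mul1r.
Qed.
End WeilKernel.

Section WeilTrace.

Variables (F : finFieldType) (chi : F -> algC).
Hypotheses (F_odd : odd #|F|) (chi_char : additive_character chi).
Hypothesis chi_nontriv : nontrivial_character chi.

Let chi0 := additive_char0 chi_char.
Let two_neq0 : 2%:R != 0 :> F := odd_card_two_neq0 F_odd.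
Local Notation gamma := (gauss_sum chi).

(** An element of trace 2 other than 1 is conjugate in SL2 to some [1, t; 0, 1], with t unique up to
    squares; this is the Legendre symbol of - t. *)
Definition unipotent_sign (b c : F) : algC :=
  if c == 0 then legendre (- b) else legendre c.

Lemma weil_kernel_trace (a b c d : F) : a * d - b * c = 1 ->
  \sum_x weil_kernel chi a b c d x x =
    if a + d == 2%:R then
      if (b == 0) && (c == 0) then #|F|%:R else unipotent_sign b c * gamma
    else legendre (a + d - 2%:R).
Proof.
rewrite /weil_kernel /unipotent_sign => det1.
have [c0 | nz_c] := eqVneq c 0.
  rewrite c0 mulr0 subr0 in det1.
  have nz_a : a != 0.
    by apply/eqP=> a0; move/eqP: det1; rewrite a0 mul0r eq_sym oner_eq0.
  have dE : d = a^-1 by apply: (mulfI nz_a); rewrite det1 mulfV.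
  (* The trace minus 2 is a times a square, so [legendre a] is the required value. *)
  have trE : a + d - 2%:R = a * ((a - 1) / a) ^+ 2 by rewrite dE; field.
  rewrite -subr_eq0 trE mulf_eq0 expf_eq0 mulf_eq0 invr_eq0 (negPf nz_a) orbF /=.
  rewrite subr_eq0 andbT; case: (eqVneq a 1) => [a1 | a_neq1].
    rewrite a1 legendre1.
    under eq_bigr do rewrite !mul1r eqxx mulr1.
    case: eqP => [-> | /eqP nz_b].
      by under eq_bigr do rewrite mulr0 mul0r chi0; rewrite sumr_const.
    rewrite -[LHS]/(quadratic_sum chi _).
    by rewrite quadratic_sum_gauss ?mulf_neq0 ?invr_eq0 // mulVKf.
  rewrite /legendre is_squareM_sqr; last first.
    by rewrite mulf_neq0 ?invr_eq0 // subr_eq0.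
  rewrite (bigD1 0) //= big1 => [|x nz_x].
    by rewrite expr0n /= !mulr0 chi0 eqxx !mulr1 addr0.
  have -> : (x == a * x) = false.
    by rewrite -{1}[x]mul1r (inj_eq (mulIf nz_x)) eq_sym (negPf a_neq1).
  by rewrite mulr0.
have sumE : \sum_(x : F) legendre (- c) / gamma *
     chi ((a * x ^+ 2 - 2%:R * x * x + d * x ^+ 2) / (2%:R * c)) =
   legendre (- c) / gamma * quadratic_sum chi ((a + d - 2%:R) / (2%:R * c)).
  rewrite mulr_sumr; apply: eq_bigr => x _; congr (_ * chi _).
  by field; rewrite two_neq0 nz_c.
have nz_g := gauss_sum_neq0 F_odd chi_char chi_nontriv.
rewrite sumE andbF -subr_eq0; case: eqP => [-> | /eqP nz_t].
  (* In trace 2 every term is 1, so the sum is q, and q / gamma is [legendre (-1)] times gamma by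
     [sqr_gauss_sum]. *)
  rewrite mul0r /quadratic_sum.
  under eq_bigr do rewrite mul0r chi0.
  rewrite sumr_const; apply: (mulIf nz_g).
  rewrite -[RHS]mulrA -expr2 sqr_gauss_sum //.
  have -> : legendre (- c) = legendre c * legendre (-1 : F).
    by rewrite -legendreM ?oppr_eq0 ?oner_neq0 // mulrN1.
  rewrite [#|(xpredT)|](_ : _ = #|F|) //.
  by field.
rewrite quadratic_sum_gauss ?mulf_neq0 ?invr_eq0 ?mulf_neq0 //.
have -> : - (2%:R * ((a + d - 2%:R) / (2%:R * c)))
    = - c * (a + d - 2%:R) * c^-1 ^+ 2.
  by field; rewrite two_neq0 nz_c.
rewrite !legendreM ?mulf_neq0 ?invr_eq0 ?oppr_eq0 // legendreV.
transitivity (legendre (- c) * legendre (- c) * (legendre c * legendre c)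
  * legendre (a + d - 2%:R)); first by field.
by rewrite !legendreK !mul1r.
Qed.

Lemma weil_kernelNN (a b c d x y : F) :
  weil_kernel chi a b c d (- x) (- y) = weil_kernel chi a b c d x y.
Proof.
rewrite /weil_kernel; case: eqP => _.
  by rewrite mulrN eqr_opp sqrrN.
by rewrite !sqrrN !mulrN mulNr opprK.
Qed.

End WeilTrace.

(** * Operators on functions as matrices, and 2 x 2 matrices in coordinates *)

Section Kernels.

Variable F : finFieldType.

Definition kernel_mx (K : F -> F -> algC) : 'M[algC]_#|F| :=
  \matrix_(i, j) K (enum_val i) (enum_val j).

Lemma sum_ord_enum (f : F -> algC) :
  \sum_(i < #|F|) f (enum_val i) = \sum_x f x.
Proof. by rewrite -big_enum_val. Qed.

Lemma kernel_mxM (K L : F -> F -> algC) :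
  kernel_mx K *m kernel_mx L = kernel_mx (fun x y => \sum_z K x z * L z y).
Proof.
apply/matrixP=> i j; rewrite !mxE -sum_ord_enum.
by apply: eq_bigr => k _; rewrite !mxE.
Qed.

Lemma kernel_mx_fvec (K : F -> F -> algC) f :
  kernel_mx K *m fvec f = fvec (fun x => \sum_y K x y * f y).
Proof.
apply/matrixP=> i j; rewrite !mxE -sum_ord_enum.
by apply: eq_bigr => k _; rewrite !mxE.
Qed.

Lemma eq_kernel_mx (K L : F -> F -> algC) : K =2 L -> kernel_mx K = kernel_mx L.
Proof. by move=> eqKL; apply/matrixP=> i j; rewrite !mxE eqKL. Qed.

Lemma eq_fvec (f g : F -> algC) : f =1 g <-> fvec f = fvec g.
Proof.
split=> [eqfg | /matrixP eqfg x].
  by apply/matrixP=> i j; rewrite !mxE eqfg.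
by have:= eqfg (enum_rank x) 0; rewrite !mxE enum_rankK.
Qed.

Lemma kernel_mx_trace (K : F -> F -> algC) : \tr (kernel_mx K) = \sum_x K x x.
Proof. by rewrite -sum_ord_enum; apply: eq_bigr => i _; rewrite mxE. Qed.

Lemma kernel_mx_delta : kernel_mx (fun x y => (y == x)%:R) = 1%:M.
Proof.
by apply/matrixP=> i j; rewrite !mxE (inj_eq enum_val_inj) eq_sym.
Qed.

Lemma GL2_mulE (g h : {'GL_2[F]}) i j :
  GLval (g * h)%g i j = GLval g i 0 * GLval h 0 j + GLval g i 1 * GLval h 1 j.
Proof.
rewrite GL_MxE mxE big_ord_recl big_ord1.
by congr (_ + _ * _); congr (GLval _ _ _); apply: val_inj.
Qed.

Lemma mx2P (A B : 'M[F]_2) :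
  A 0 0 = B 0 0 -> A 0 1 = B 0 1 -> A 1 0 = B 1 0 -> A 1 1 = B 1 1 -> A = B.
Proof.
move=> eq00 eq01 eq10 eq11; apply/matrixP=> i j.
have ord2 (k : 'I_2) : k = 0 \/ k = 1.
  by case: k => [[|[|//]] lt_k]; [left | right]; apply: val_inj.
by have [->|->] := ord2 i; have [->|->] := ord2 j.
Qed.

Lemma det_mx2 (M : 'M[F]_2) : \det M = M 0 0 * M 1 1 - M 0 1 * M 1 0.
Proof.
rewrite (expand_det_row _ 0) big_ord_recl big_ord1 /cofactor !det_mx11 !mxE.
have -> : lift 0 0 = 1 :> 'I_2 by apply: val_inj.
have -> : lift 1 0 = 0 :> 'I_2 by apply: val_inj.
by rewrite /= expr0 expr1 mul1r mulN1r mulrN.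
Qed.

Lemma mxtrace2 (M : 'M[F]_2) : \tr M = M 0 0 + M 1 1.
Proof.
by rewrite /mxtrace big_ord_recl big_ord1; congr (_ + M _ _); apply: val_inj.
Qed.

Lemma SL2P (g : {'GL_2[F]}) :
  reflect (GLval g 0 0 * GLval g 1 1 - GLval g 0 1 * GLval g 1 0 = 1)
          (g \in SL2 F).
Proof. by rewrite inE det_mx2; apply: eqP. Qed.

End Kernels.

Section WeilRepresentation.

Variables (F : finFieldType) (chi : F -> algC).
Hypotheses (F_odd : odd #|F|) (chi_char : additive_character chi).
Hypothesis chi_nontriv : nontrivial_character chi.

Let chi0 := additive_char0 chi_char.
Let two_neq0 : 2%:R != 0 :> F := odd_card_two_neq0 F_odd.

Definition weil_mx (g : {'GL_2[F]}) : 'M[algC]_#|F| :=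
  kernel_mx (weil_kernel chi (GLval g 0 0) (GLval g 0 1)
                             (GLval g 1 0) (GLval g 1 1)).

Lemma weil_mx_repr : mx_repr (SL2 F) weil_mx.
Proof.
split=> [|g h /SL2P det_g /SL2P det_h]; last first.
  rewrite /weil_mx kernel_mxM; apply: eq_kernel_mx => x y.
  by rewrite weil_kernelM // !GL2_mulE.
rewrite -kernel_mx_delta; apply: eq_kernel_mx => x y.
rewrite !GL_1E !mxE /weil_kernel /= eqxx mulr0 mulr0 mul0r chi0 mulr1 mul1r.
by rewrite legendre1 mul1r.
Qed.

Definition weil_repr : mx_representation algC (SL2 F) #|F| :=
  MxRepresentation weil_mx_repr.

Lemma weil_repr_oscillator : is_oscillator chi weil_repr.
Proof.
split=> [g a f gE | g f gE | g c f nz_c gE];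
  rewrite [weil_repr g]/(weil_mx g) /weil_mx gE !mxE /= kernel_mx_fvec;
  apply/eq_fvec => x;
  rewrite /weil_kernel ?eqxx ?oppr_eq0 ?oner_eq0 ?(negPf nz_c).
- rewrite -(sum_delta (fun y => chi (2%:R^-1 * a * x ^+ 2) * f y) x).
  by apply: eq_bigr => y _; rewrite legendre1 !mul1r mulrAC.
- rewrite opprK legendre1 mul1r mulr_sumr; apply: eq_bigr => y _.
  rewrite -mulrA; congr (_ * (chi _ * _)).
  by field; rewrite ?oppr_eq0 ?two_neq0 ?oner_neq0.
rewrite -(sum_delta (fun y => legendre c * f y) (c^-1 * x)).
by apply: eq_bigr => y _; rewrite legendreV !(mulr0, mul0r) chi0 mulr1 mulrAC.
Qed.

Lemma cfRepr_weil g : g \in SL2 F ->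
  cfRepr weil_repr g =
    if \tr (GLval g) == 2%:R then
      if g == 1%g then #|F|%:R
      else unipotent_sign (GLval g 0 1) (GLval g 1 0) * gauss_sum chi
    else legendre (\tr (GLval g) - 2%:R).
Proof.
move=> Gg; have /SL2P det_g := Gg.
rewrite cfunE Gg mulr1n [weil_repr g]/(weil_mx g) kernel_mx_trace.
rewrite weil_kernel_trace //.
rewrite mxtrace2; case: eqP => // tr2.
suff -> : (GLval g 0 1 == 0) && (GLval g 1 0 == 0) = (g == 1%g) by [].
apply/andP/eqP=> [[/eqP b0 /eqP c0] | ->]; last by rewrite GL_1E !mxE.
have [|aE dE] := mul1_add2 _ tr2; first by rewrite -det_g b0 mul0r subr0.
have eq_mx : GLval g = GLval 1%g.
  rewrite GL_1E; apply: mx2P; rewrite mxE.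
  - by rewrite aE.
  - by rewrite b0.
  - by rewrite c0.
  by rewrite dE.
by apply/val_inj; exact eq_mx.
Qed.

(** For s = 1 or -1, the projector onto the functions with f(- x) = s * f(x). *)
Definition parity_mx (s : algC) : 'M[algC]_#|F| :=
  kernel_mx (fun x y => 2%:R^-1 * ((y == x)%:R + s * (y == - x)%:R)).

Lemma parity_mx_fvec s f :
  parity_mx s *m fvec f = fvec (fun x => 2%:R^-1 * (f x + s * f (- x))).
Proof.
rewrite kernel_mx_fvec; apply/eq_fvec => x.
rewrite -[f x in RHS](sum_delta f x) -[f (- x)](sum_delta f (- x)) mulr_sumr.
rewrite -big_split mulr_sumr; apply: eq_bigr => y _ /=; ring.
Qed.

Lemma fvec_enum_rank (v : 'cV[algC]_#|F|) :
  v = fvec (fun x => v (enum_rank x) 0).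
Proof. by apply/matrixP=> i j; rewrite !mxE enum_valK ord1. Qed.

Lemma eq_mx_fvec m (A B : 'M[algC]_(m, #|F|)) :
  (forall f, A *m fvec f = B *m fvec f) -> A = B.
Proof.
move=> eqAB; apply/matrixP=> i j.
(* The test function is the indicator of the j-th element of F, which extracts column j. *)
have := eqAB (fun x => delta_mx j 0 (enum_rank x) (0 : 'I_1)).
by rewrite -fvec_enum_rank -!colE => /matrixP/(_ i 0); rewrite !mxE.
Qed.

Lemma parity_mx_idem s : s ^+ 2 = 1 -> parity_mx s *m parity_mx s = parity_mx s.
Proof.
move=> s2; apply: eq_mx_fvec => f; rewrite -mulmxA !parity_mx_fvec.
apply/eq_fvec=> x; rewrite opprK.
transitivity (2%:R^-1 * 2%:R^-1 * (f x + s ^+ 2 * f x + 2%:R * s * f (- x))).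
  by ring.
by rewrite s2; field.
Qed.

Lemma parity_mx_sum : parity_mx 1 + parity_mx (-1) = 1%:M.
Proof.
apply: eq_mx_fvec => f; rewrite mulmxDl !parity_mx_fvec mul1mx.
by apply/matrixP=> i j; rewrite !mxE; field.
Qed.

Lemma parity_mx_comm s g :
  parity_mx s *m weil_repr g = weil_repr g *m parity_mx s.
Proof.
apply: eq_mx_fvec => f; rewrite -!mulmxA parity_mx_fvec [weil_repr g]/(weil_mx g).
rewrite [weil_mx g *m fvec f]kernel_mx_fvec parity_mx_fvec kernel_mx_fvec.
apply/eq_fvec => x.
set K := weil_kernel _ _ _ _ _.
have -> : \sum_y K (- x) y * f y = \sum_y K x y * f (- y).
  rewrite (reindex_inj oppr_inj); apply: eq_bigr => y _ /=.
  by rewrite /K weil_kernelNN.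
rewrite mulr_sumr -big_split mulr_sumr; apply: eq_bigr => y _ /=; ring.
Qed.

End WeilRepresentation.

(** * Irreducibility of the even and odd parts *)

Section Summands.

Variables (gT : finGroupType) (G : {group gT}).

(** Take a rank factorization P = B *m R. Cancelling B on the left and R on the right in P *m P = P
    gives R *m B = 1, and the summand is R *m rho g *m B. *)
Lemma mx_repr_summand n (rho : mx_representation algC G n) (P : 'M[algC]_n) :
    P *m P = P -> (forall g, g \in G -> P *m rho g = rho g *m P) ->
  exists m (sigma : mx_representation algC G m) B R,
    [/\ B *m R = P, R *m B = 1%:M
      & forall g, g \in G -> rho g *m B = B *m sigma g].
Proof.
move=> PP commP.
have [r [B [R [BR [Bl BlK] [Rr RrK]]]]] :
    exists r (B : 'M_(n, r)) (R : 'M_(r, n)),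
    [/\ B *m R = P, exists Bl, Bl *m B = 1%:M & exists Rr, R *m Rr = 1%:M].
  exists (\rank P), (col_base P), (row_base P); rewrite mulmx_base.
  by split=> //;
    [apply/row_fullP/col_base_full | apply/row_freeP/row_base_free].
have RB : R *m B = 1%:M.
  have : Bl *m (P *m P) *m Rr = Bl *m P *m Rr by rewrite PP.
  by rewrite -BR !mulmxA BlK mul1mx -!mulmxA RrK !mulmx1.
have rhoB g : g \in G -> rho g *m B = B *m (R *m rho g *m B).
  by move=> Gg; rewrite !mulmxA BR commP // -BR -!mulmxA RB mulmx1.
have sigmaP : mx_repr G (fun g => R *m rho g *m B).
  split=> [|g h Gg Gh]; first by rewrite repr_mx1 mulmx1.
  by rewrite repr_mxM // -[RHS]mulmxA -rhoB // !mulmxA.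
by exists _, (MxRepresentation sigmaP), B, R.
Qed.

Lemma mx_rsim_invertible n1 n2 (rho : mx_representation algC G n1)
    (sigma : mx_representation algC G n2) :
    mx_rsim rho sigma ->
  exists D E, [/\ D *m E = 1%:M, E *m D = 1%:M
    & forall g, g \in G -> rho g *m D = D *m sigma g].
Proof.
case=> D def_n; case: _ / def_n sigma D => sigma D freeD homD.
have uD : D \in unitmx by rewrite -row_free_unit.
by exists D, (invmx D); rewrite mulmxV ?mulVmx.
Qed.

(** The norm of the sum is a sum of four natural numbers, two of them positive; being at most 2, it
    makes both norms 1. *)
Lemma char_sum_irr (alpha beta : 'CF(G)) :
    alpha \is a character -> beta \is a character ->
    alpha != 0 -> beta != 0 -> '[alpha + beta] <= 2%:R ->
  alpha \in irr G /\ beta \in irr G.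
Proof.
move=> Na Nb nz_a nz_b.
have /natrP[a aE] := Cnat_cfdot_char Na Na.
have /natrP[b bE] := Cnat_cfdot_char Nb Nb.
have /natrP[c cE] := Cnat_cfdot_char Na Nb.
have /natrP[d dE] := Cnat_cfdot_char Nb Na.
have a_gt0 : (0 < a)%N by rewrite -(ltr_nat algC) -aE cfnorm_gt0.
have b_gt0 : (0 < b)%N by rewrite -(ltr_nat algC) -bE cfnorm_gt0.
rewrite cfdotDl !cfdotDr aE bE cE dE -!natrD ler_nat !irrEchar Na Nb aE bE.
rewrite !(eqr_nat _ _ 1) => le2.
have [a1 b1] : a = 1%N /\ b = 1%N by split; lia.
by rewrite a1 b1.
Qed.

End Summands.

(** * The number of elements of trace 2 and the order of SL2 *)

Section Counting.

Variable F : finFieldType.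

Definition trace2_set : {set {'GL_2[F]}} :=
  [set g in SL2 F | \tr (GLval g) == 2%:R].

(** If b is nonzero, the pair (b, a) determines d by the trace and c by the determinant. If b = 0,
    then a = d = 1 and c alone is free. *)
Lemma card_trace2 : (#|trace2_set| <= #|F| ^ 2)%N.
Proof.
pose f (g : {'GL_2[F]}) :=
  (GLval g 0 1, if GLval g 0 1 == 0 then GLval g 1 0 else GLval g 0 0).
rewrite expnS expn1 -card_prod -(@card_in_imset _ _ f); first exact: max_card.
move=> g h /setIdP[/SL2P det_g /eqP tr_g] /setIdP[/SL2P det_h /eqP tr_h] [].
rewrite !mxtrace2 in tr_g tr_h.
set a := GLval g 0 0 in det_g tr_g *; set b := GLval g 0 1 in det_g *.
set c := GLval g 1 0 in det_g *; set d := GLval g 1 1 in det_g tr_g *.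
move=> eq_b; rewrite -eq_b in det_h *.
suff : (if b == 0 then c else a)
      = (if b == 0 then GLval h 1 0 else GLval h 0 0) ->
    [/\ a = GLval h 0 0, c = GLval h 1 0 & d = GLval h 1 1].
  move=> eqs /eqs[eq_a eq_c eq_d].
  have eq_mx : GLval g = GLval h by apply: mx2P.
  by apply/val_inj; exact eq_mx.
case: eqP => [b0 | /eqP nz_b] eq_ca.
  rewrite b0 !mul0r !subr0 in det_g det_h.
  have [-> ->] := mul1_add2 det_g tr_g.
  by have [-> ->] := mul1_add2 det_h tr_h.
have eq_d : d = GLval h 1 1.
  by apply: (addrI a); rewrite tr_g eq_ca tr_h.
split=> //; apply: (mulfI nz_b); apply: oppr_inj.
by apply: (addrI (a * d)); rewrite det_g eq_ca eq_d det_h.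
Qed.

(** Each of the q - 1 fibres of the determinant is empty or contained in a coset of SL2. *)
Lemma card_GL2_le_SL2 : (#|'GL_2[F]%g| <= #|F|.-1 * #|SL2 F|)%N.
Proof.
pose D := [pred x : F | x != 0].
have Udet (g : {'GL_2[F]}) : \det (GLval g) \is a GRing.unit.
  by rewrite -unitmxE GL_unitmx.
rewrite -sum1_card (partition_big (fun g => \det (GLval g)) (mem D)) /=; last first.
  by move=> g _; rewrite inE -unitfE.
have <- : #|D| = #|F|.-1.
  by rewrite -(cardC1 (0 : F)); apply: eq_card => x; rewrite !inE.
rewrite -sum_nat_const; apply: leq_sum => x _.
rewrite sum1_card.
have [g0 /andP[_ /eqP det_g0] | no_g] :=
  pickP [pred g | (g \in 'GL_2[F]%g) && (\det (GLval g) == x)]; last first.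
  by rewrite (eq_card0 no_g).
rewrite -(card_lcoset (SL2 F) g0); apply: subset_leq_card; apply/subsetP=> g.
rewrite unfold_in => /andP[_ /eqP det_g].
rewrite mem_lcoset inE GL_MxE GL_VxE det_mulmx det_inv det_g0 det_g mulVr //.
by rewrite -det_g.
Qed.

Lemma card_SL2_ge : (#|F| * (#|F| ^ 2 - 1) <= #|SL2 F|)%N.
Proof.
have q_gt1 : (1 < #|F|)%N by apply: finNzRing_gt1.
have := card_GL2_le_SL2; rewrite card_GL_2.
case: #|F| q_gt1 => [|[|q]] //= _.
rewrite expnS expn1 mulnCA -!mulnA leq_pmul2l //.
by apply: leq_trans; rewrite -(exp1n 2) subn_sqr subn1 addn1 /= mulnA.
Qed.

End Counting.

(** * Generation of SL2 by its elements of trace 2 *)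

Section SL2Generation.

Variable F : finFieldType.

Lemma GL2_of_det1 (M : 'M[F]_2) :
  \det M = 1 -> exists2 g : {'GL_2[F]}, GLval g = M & g \in SL2 F.
Proof.
move=> det1; have UM : M \in unitmx by rewrite unitmxE det1 unitr1.
have gE : GLval (FinRing.Unit UM : {'GL_2[F]}) = M by [].
by exists (FinRing.Unit UM) => //; rewrite inE gE det1.
Qed.

(** If c is nonzero, then g = [1, (a-1)/c; 0, 1] * [1, 0; c, 1] * [1, (d-1)/c; 0, 1], and all three
    factors have trace 2. *)
Lemma SL2_sub_group (K : {group {'GL_2[F]}}) :
  trace2_set F \subset K -> SL2 F \subset K.
Proof.
move=> /subsetP sUK.
have trace2P (M : 'M[F]_2) : M 0 0 = 1 -> M 1 1 = 1 -> M 0 1 * M 1 0 = 0 ->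
    exists2 g : {'GL_2[F]}, GLval g = M & g \in K.
  move=> M00 M11 M01.
  have [|g gE Gg] := @GL2_of_det1 M.
    by rewrite det_mx2 M00 M11 M01 mul1r subr0.
  by exists g => //; apply: sUK; rewrite inE Gg gE mxtrace2 M00 M11 /=.
have upperP x : exists2 g : {'GL_2[F]}, GLval g = mx2 1 x 0 1 & g \in K.
  by apply: trace2P; rewrite !mxE /= ?mulr0.
have lowerP x : exists2 g : {'GL_2[F]}, GLval g = mx2 1 0 x 1 & g \in K.
  by apply: trace2P; rewrite !mxE /= ?mul0r.
have nz_lower g : g \in SL2 F -> GLval g 1 0 != 0 -> g \in K.
  move=> /SL2P det_g nz_c.
  have [u uE Ku] := upperP ((GLval g 0 0 - 1) / GLval g 1 0).
  have [l lE Kl] := lowerP (GLval g 1 0).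
  have [v vE Kv] := upperP ((GLval g 1 1 - 1) / GLval g 1 0).
  suff eq_mx : GLval g = GLval (u * l * v)%g.
    have -> : g = (u * l * v)%g by apply/val_inj; exact eq_mx.
    by rewrite !groupM.
  have bE : GLval g 0 1 = (GLval g 0 0 * GLval g 1 1 - 1) / GLval g 1 0.
    by apply: (mulIf nz_c); rewrite mulfVK // -det_g; ring.
  by apply: mx2P; rewrite !GL2_mulE uE lE vE !mxE /= ?bE; field.
apply/subsetP=> g Gg.
have [c0 | nz_c] := eqVneq (GLval g 1 0) 0; last exact: nz_lower.
(* Right multiplication by [1, 0; 1, 1] changes the lower left entry from 0 to d, which is nonzero
   since a * d = 1. *)
have [l lE Kl] := lowerP 1.
have Gl : l \in SL2 F by apply/SL2P; rewrite lE !mxE /=; ring.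
rewrite -(groupMr _ Kl); apply: nz_lower; first by rewrite groupM.
rewrite GL2_mulE lE !mxE /= c0 mul0r add0r mulr1.
apply/eqP=> d0; have /SL2P/eqP := Gg.
by rewrite c0 d0 !mulr0 subr0 eq_sym oner_eq0.
Qed.

End SL2Generation.

Section GroupSums.

Variables (gT : finGroupType) (G : {group gT}).

Lemma sum_indicator (A : {set gT}) (f : gT -> algC) :
  A \subset G -> \sum_(g in G) f g * (g \in A)%:R = \sum_(g in A) f g.
Proof.
move/subsetP=> sAG.
rewrite [RHS](eq_bigl (fun g => (g \in G) && (g \in A))) => [|g].
  rewrite big_mkcondr; apply: eq_bigr => g _.
  by case: ifP; rewrite ?mulr1 ?mulr0.
by apply/idP/andP=> [Ag | []//]; rewrite sAG.
Qed.

Lemma sum_delta1 (f : gT -> algC) : \sum_(g in G) f g * (g == 1%g)%:R = f 1%g.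
Proof.
rewrite (bigD1 1%g) //= eqxx mulr1 big1 ?addr0 // => g /andP[_ /negPf->].
by rewrite mulr0.
Qed.

End GroupSums.

(** * The norm of the oscillator character *)

Section ParityDecomposition.

Variables (F : finFieldType) (chi : F -> algC).
Hypotheses (F_odd : odd #|F|) (chi_char : additive_character chi).
Hypothesis chi_nontriv : nontrivial_character chi.

Local Notation G := (SL2 F).
Local Notation W := (weil_repr F_odd chi_char chi_nontriv).
Local Notation q := #|F|.

Lemma unipotent_signK (b c : F) : unipotent_sign b c * unipotent_sign b c = 1.
Proof. by rewrite /unipotent_sign; case: ifP; rewrite legendreK. Qed.

Lemma conj_unipotent_sign (b c : F) :
  (unipotent_sign b c)^* = unipotent_sign b c.
Proof. by rewrite /unipotent_sign; case: ifP; rewrite conj_legendre. Qed.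

Lemma cfRepr_weil_norm g : g \in G ->
  cfRepr W g * (cfRepr W g)^* =
    1 + (q * q.-1)%:R * (g == 1%g)%:R + q.-1%:R * (g \in trace2_set F)%:R.
Proof.
move=> Gg; rewrite cfRepr_weil // [g \in trace2_set F]inE Gg /=.
have q_gt0 : (0 < q)%N by apply/card_gt0P; exists 0.
have [-> | ] := eqVneq g 1%g.
  rewrite GL_1E mxtrace1 eqxx !mulr1 conj_natr ?natr_nat //.
  by rewrite natrM -{1 2 3}(prednK q_gt0) -natr1; ring.
case: ifP => _ _; rewrite mulr0 addr0; last first.
  by rewrite conj_legendre legendreK mulr0 addr0.
rewrite rmorphM /= conj_unipotent_sign mulrACA unipotent_signK mul1r mulr1.
by rewrite gauss_sum_norm // -{1}(prednK q_gt0) -natr1 addrC.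
Qed.

(** With U the elements of trace 2, |G| times the norm is |G| + q(q - 1) + (q - 1)|U|. As |U| <=
    q^2, this is at most |G| + q(q^2 - 1) <= 2|G|. *)
Lemma cfnorm_weil : '[cfRepr W] <= 2%:R.
Proof.
rewrite cfdotE (eq_bigr _ cfRepr_weil_norm) !big_split /= sumr_const.
have sUG : trace2_set F \subset G by apply/subsetP=> g /setIdP[].
rewrite (sum_delta1 G (fun=> (q * q.-1)%:R)).
rewrite (sum_indicator (fun=> q.-1%:R) sUG) sumr_const.
rewrite ler_pdivrMl ?(gt0CG G) // -mulrnA -natrM -!natrD ler_nat.
rewrite muln2 -addnn -addnA leq_add2l; apply: leq_trans (card_SL2_ge F).
apply: (@leq_trans (q * q.-1 + q.-1 * q ^ 2)%N).
  by rewrite leq_add2l leq_mul2l card_trace2 orbT.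
by rewrite -(exp1n 2) subn_sqr subn1 addn1 expnS expn1; apply/eq_leq; ring.
Qed.

End ParityDecomposition.

(** * The even and odd parts as irreps *)

Section ParityIrreps.

Variables (F : finFieldType) (chi : F -> algC).
Hypotheses (F_odd : odd #|F|) (chi_char : additive_character chi).
Hypothesis chi_nontriv : nontrivial_character chi.

Local Notation G := (SL2 F).
Local Notation W := (weil_repr F_odd chi_char chi_nontriv).

Lemma parity_mx_fixed s f : s ^+ 2 = 1 ->
  (forall y : F, f (- y) = s * f y) <-> parity_mx F s *m fvec f = fvec f.
Proof.
move=> s2; rewrite parity_mx_fvec -eq_fvec; split=> [fN x | fE y].
  by rewrite fN mulrA -expr2 s2 mul1r; field.
have fNE : s * f (- y) = f y.
  transitivity (2%:R * (2%:R^-1 * (f y + s * f (- y))) - f y); first by field.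
  by rewrite fE; ring.
by rewrite -[in RHS]fNE mulrA -expr2 s2 mul1r.
Qed.

Lemma even_function_parity f :
  even_function f <-> parity_mx F 1 *m fvec f = fvec f.
Proof.
rewrite -parity_mx_fixed ?expr1n //.
by split=> fN y; move: (fN y); rewrite mul1r.
Qed.

Lemma odd_function_parity f :
  odd_function f <-> parity_mx F (-1) *m fvec f = fvec f.
Proof.
rewrite -parity_mx_fixed ?sqrrN ?expr1n //.
by split=> fN y; move: (fN y); rewrite mulN1r.
Qed.

(** The columns of B span the image of P. A change of basis D makes the action on it equal to the
    chosen representative ['Chi_i], not just similar to it. *)
Lemma acts_on_as_summand (Q : (F -> algC) -> Prop) (P : 'M[algC]_#|F|) m
    (sigma : mx_representation algC G m) B R (i : Iirr G) :
    (forall f, Q f <-> P *m fvec f = fvec f) ->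
    B *m R = P -> R *m B = 1%:M ->
    (forall g, g \in G -> W g *m B = B *m sigma g) ->
    cfRepr sigma = 'chi_i ->
  acts_on_as W Q 'Chi_i.
Proof.
move=> QP BR RB WB; rewrite -irrRepr.
case/cfRepr_inj/mx_rsim_invertible=> D [E [DE ED homD]].
exists (B *m D); split.
- apply/row_fullP; exists (E *m R).
  by rewrite mulmxA -(mulmxA E) RB mulmx1.
- move=> f; rewrite QP -BR; split=> [fE | [v ->]].
    exists (E *m (R *m fvec f)).
    by rewrite -!mulmxA (mulmxA D) DE mul1mx mulmxA.
  by rewrite -!mulmxA (mulmxA R) RB mul1mx.
by move=> g Gg; rewrite mulmxA WB // -!mulmxA homD.
Qed.

Lemma parity_summand s : s ^+ 2 = 1 ->
  exists m (sigma : mx_representation algC G m) B R,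
    [/\ B *m R = parity_mx F s, R *m B = 1%:M
      & forall g, g \in G -> W g *m B = B *m sigma g].
Proof.
move=> s2; apply: mx_repr_summand => [|g _].
  by rewrite parity_mx_idem.
by rewrite parity_mx_comm.
Qed.

Lemma mxtrace_summand (P : 'M[algC]_#|F|) m
    (sigma : mx_representation algC G m) B R g : B *m R = P -> R *m B = 1%:M ->
  W g *m B = B *m sigma g -> \tr (sigma g) = \tr (W g *m P).
Proof.
move=> BR RB WB; rewrite -BR mulmxA WB mxtrace_mulC mulmxA RB mul1mx //.
Qed.

(** A nonzero vector fixed by P excludes dimension 0, and the character at 1 is the dimension. *)
Lemma cfRepr_summand_neq0 (P : 'M[algC]_#|F|) m
    (sigma : mx_representation algC G m) B (R : 'M_(m, #|F|)) f x :
  B *m R = P -> P *m fvec f = fvec f -> f x != 0 -> cfRepr sigma != 0.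
Proof.
case: m sigma B R => [|m] sigma B R BR Pf nz_fx.
  case/eqP: nz_fx; apply: (proj2 (eq_fvec f (fun=> 0)) _ x).
  rewrite -Pf -BR [B]thinmx0 !mul0mx; apply/matrixP=> i j; by rewrite !mxE.
apply/eqP=> /cfunP/(_ 1%g); rewrite cfRepr1 cfunE => /eqP.
by rewrite pnatr_eq0.
Qed.

Lemma weil_char_parity :
  exists i j, [/\ oscillator_irrep chi i, oscillator_irrep chi j
                & cfRepr W = 'chi_i + 'chi_j].
Proof.
have two_neq0 := odd_card_two_neq0 F_odd.
have [m [sigma [B [R [BR RB WB]]]]] := parity_summand (expr1n _ 2).
have N1s : (-1) ^+ 2 = 1 :> algC by rewrite sqrrN expr1n.
have [n [tau [C [S [CS SC WC]]]]] := parity_summand N1s.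
have W_sum : cfRepr W = cfRepr sigma + cfRepr tau.
  apply/cfun_inP=> g Gg; rewrite !cfunE Gg !mulr1n.
  rewrite (mxtrace_summand BR RB (WB g Gg)) (mxtrace_summand CS SC (WC g Gg)).
  by rewrite -raddfD -mulmxDr parity_mx_sum mulmx1.
have nz_sigma : cfRepr sigma != 0.
  apply: (cfRepr_summand_neq0 sigma (f := fun=> 1) (x := 0) BR).
    exact/even_function_parity.
  exact: oner_neq0.
have nz_tau : cfRepr tau != 0.
  (* A nonzero odd function: 1 and -1 differ because 2 is nonzero in F. *)
  pose f (x : F) : algC := (x == 1)%:R - (x == -1)%:R.
  apply: (cfRepr_summand_neq0 tau (f := f) (x := 1) CS).
    apply/odd_function_parity=> y; rewrite /f opprB eqr_opp.
    by rewrite eqr_oppLR.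
  rewrite /f eqxx -addr_eq0 -mulr2n (negPf two_neq0) subr0; exact: oner_neq0.
have [|/irrP[i iE] /irrP[j jE]] :=
  char_sum_irr (cfRepr_char sigma) (cfRepr_char tau) nz_sigma nz_tau.
  by rewrite -W_sum cfnorm_weil.
have Wosc := weil_repr_oscillator F_odd chi_char chi_nontriv.
exists i, j; split; last by rewrite W_sum iE jE.
  exists W; split=> //; left.
  exact: (acts_on_as_summand even_function_parity BR RB WB iE).
exists W; split=> //; right.
exact: (acts_on_as_summand odd_function_parity CS SC WC jE).
Qed.

End ParityIrreps.

(** * The product of two oscillator characters *)

Section TensorSquare.

Variables (F : finFieldType) (F_odd : odd #|F|).
Variables (psi : F -> algC) (eps : F).
Hypotheses (psi_char : additive_character psi).
Hypothesis psi_nontriv : nontrivial_character psi.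
Hypothesis eps_nonsquare : ~~ is_square eps.

Local Notation G := (SL2 F).
Local Notation q := #|F|.
Let nz_eps : eps != 0 := nonsquare_neq0 eps_nonsquare.
Let psi_eps_char := additive_charZ psi_char eps.
Let psi_eps_nontriv := nontrivial_charZ nz_eps psi_nontriv.
Local Notation omega := (cfRepr (weil_repr F_odd psi_char psi_nontriv)).
Local Notation omega' :=
  (cfRepr (weil_repr F_odd psi_eps_char psi_eps_nontriv)).

(** Off trace 2 both characters equal the same sign; at nontrivial elements of trace 2 they are
    opposite; at 1 both are q. *)
Lemma weil_tensor_char g : g \in G ->
  (omega * (omega + omega')) g =
    2%:R * (1 + (q ^ 2)%:R * (g == 1%g)%:R - (g \in trace2_set F)%:R).
Proof.
move=> Gg; rewrite cfunE [X in _ * X]cfunE !cfRepr_weil // gauss_sumZ_nonsquare //.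
rewrite [g \in trace2_set F]inE Gg /=.
have [g1 | _] := eqVneq g 1%g.
  by rewrite g1 GL_1E mxtrace1 eqxx natrX /=; ring.
case: ifP => _ /=; rewrite mulr0 addr0 ?subrr ?subr0; first by ring.
by rewrite mulrDr legendreK; ring.
Qed.

Lemma weil_tensor_constt j : '[omega * (omega + omega'), 'chi_j] != 0.
Proof.
have sUG : trace2_set F \subset G by apply/subsetP=> g /setIdP[].
apply/eqP=> dot0.
(* Orthogonality to ['chi_j], with the sum over trace 2 isolated. *)
have sum_conj : \sum_(g in trace2_set F) ('chi_j g)^* =
    #|G|%:R * (j == 0)%:R + (q ^ 2)%:R * 'chi_j 1%g.
  have oneE : \sum_(g in G) ('chi_j g)^* = #|G|%:R * (j == 0)%:R.
    have := cfdot_irr (0 : Iirr G) j; rewrite irr0 cfdotE eq_sym => <-.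
    rewrite mulVKf ?neq0CG //; apply: eq_bigr => g Gg.
    by rewrite cfun1E Gg mul1r.
  move/eqP: dot0; rewrite cfdotE mulf_eq0 invr_eq0 (negPf (neq0CG G)) /=.
  rewrite (eq_bigr (fun g => 2%:R
      * (('chi_j g)^* + (q ^ 2)%:R * ('chi_j g)^* * (g == 1%g)%:R
         - ('chi_j g)^* * (g \in trace2_set F)%:R))) => [|g Gg]; last first.
    by rewrite weil_tensor_char //; ring.
  rewrite -mulr_sumr mulf_eq0 pnatr_eq0 /= sumrB big_split /=.
  rewrite (sum_delta1 G (fun g => (q ^ 2)%:R * ('chi_j g)^*)).
  rewrite (sum_indicator (fun g => ('chi_j g)^*) sUG) oneE subr_eq0 => /eqP <-.
  by rewrite conj_Creal // ger0_real // char1_ge0 ?irr_char.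
have chi1_gt0 := irr1_gt0 j.
have norm_le g : `|('chi_j g)^*| <= 'chi_j 1%g.
  by rewrite norm_conjC char1_ge_norm ?irr_char.
have le_card : #|trace2_set F|%:R * 'chi_j 1%g <= (q ^ 2)%:R * 'chi_j 1%g.
  by rewrite ler_pM2r // ler_nat card_trace2.
have le_sum : #|G|%:R * (j == 0)%:R + (q ^ 2)%:R * 'chi_j 1%g
    <= #|trace2_set F|%:R * 'chi_j 1%g.
  rewrite -[leLHS]ger0_norm -?sum_conj.
    apply: le_trans (ler_norm_sum _ _ _) _.
    by rewrite mulr_natl -sumr_const ler_sum.
  by rewrite sum_conj addr_ge0 ?mulr_ge0 ?ler0n // ltW.
(* The two bounds sandwich the sum; an extra |G| would not fit between them. *)
have j0 : (j == 0) = false.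
  have := le_trans le_sum le_card; rewrite gerDr pmulr_rle0 ?gt0CG //.
  by rewrite lern0 eqb0 => /negPf.
rewrite j0 mulr0 add0r in sum_conj le_sum.
(* Now the triangle inequality is an equality with every term of norm at most ['chi_j 1], so each
   term equals ['chi_j 1]. *)
have sum_eq : \sum_(g in trace2_set F) ('chi_j g)^*
    = \sum_(g in trace2_set F) 'chi_j 1%g.
  rewrite sum_conj sumr_const -[RHS]mulr_natl.
  by apply/eqP; rewrite eq_le le_sum le_card.
have chiU g : g \in trace2_set F -> 'chi_j g = 'chi_j 1%g.
  move=> Ug; apply: (can_inj (@conjCK algC)).
  rewrite (normC_sum_upper _ sum_eq) //.
  by rewrite conj_Creal // ger0_real // ltW.
suff : G \subset cfker 'chi_j by rewrite subGcfker j0.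
apply: SL2_sub_group; apply/subsetP=> g Ug.
rewrite -[g \in _]/(g \in cfker 'chi_j) cfkerEirr.
by rewrite inE chiU.
Qed.

End TensorSquare.

(** * From constituents to the filtration *)

Section Proposition.

Variables (F : finFieldType) (F_odd : odd #|F|).
Variables (psi : F -> algC) (eps : F).
Hypotheses (psi_char : additive_character psi).
Hypothesis psi_nontriv : nontrivial_character psi.
Hypothesis eps_nonsquare : ~~ is_square eps.

(** The product of oscillator characters expands into eight products of two of the four irreps; if
    ['chi_j] occurred in none of them, its multiplicity in the sum would be 0. *)
Lemma occurs_in_rank2 (j : Iirr (SL2 F)) :
  occurs_in_rank (four_irreps psi eps) 2 j.
Proof.
have := weil_tensor_constt F_odd psi_char psi_nontriv eps_nonsquare j.
have [a [b [osc_a osc_b ->]]] := weil_char_parity F_odd psi_char psi_nontriv.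
have [c [d [osc_c osc_d ->]]] := weil_char_parity F_odd
  (additive_charZ psi_char eps)
  (nontrivial_charZ (nonsquare_neq0 eps_nonsquare) psi_nontriv).
have prod_occurs i k : four_irreps psi eps i -> four_irreps psi eps k ->
    occurs_in_rank (four_irreps psi eps) 2 j \/ '['chi_i * 'chi_k, 'chi_j] = 0.
  move=> Si Sk; have [dot0 | dot_neq0] := eqVneq '['chi_i * 'chi_k, 'chi_j] 0.
    by right.
  left; exists [:: i; k]; split=> //.
    by move=> l; rewrite !inE => /orP[]/eqP->.
  (* [tensor_product] ends with a trivial factor, whose character is 1. *)
  have triv1 : cfRepr (triv_repr (SL2 F)) = 1.
    by apply/cfun_inP=> g Gg; rewrite cfunE cfun1E Gg mxtrace1.
  by rewrite irr_consttE /= -!cfRepr_prod !irrRepr triv1 mulr1.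
have [Sa Sb] : four_irreps psi eps a /\ four_irreps psi eps b by split; left.
have [Sc Sd] : four_irreps psi eps c /\ four_irreps psi eps d by split; right.
rewrite mulrDl !mulrDr !cfdotDl => sum_neq0.
have [//|aa0] := prod_occurs a a Sa Sa; have [//|ab0] := prod_occurs a b Sa Sb.
have [//|ac0] := prod_occurs a c Sa Sc; have [//|ad0] := prod_occurs a d Sa Sd.
have [//|ba0] := prod_occurs b a Sb Sa; have [//|bb0] := prod_occurs b b Sb Sb.
have [//|bc0] := prod_occurs b c Sb Sc; have [//|bd0] := prod_occurs b d Sb Sd.
by rewrite aa0 ab0 ac0 ad0 ba0 bb0 bc0 bd0 !addr0 eqxx in sum_neq0.
Qed.

End Proposition.

Theorem proposition2p2p1 (F : finFieldType) (F_odd : odd #|F|)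
    (psi : F -> algC) (psi_char : additive_character psi)
    (psi_nontriv : nontrivial_character psi)
    (eps : F) (eps_nonsquare : ~~ is_square eps) :
  forall phi : 'CF(SL2 F),
    tensor_rank_filtration (four_irreps psi eps) 2 phi
    <-> phi \in 'Z[irr (SL2 F)]%g.
Proof.
move=> phi; split=> [[z [_ ->]] | Zphi].
  by apply: rpred_sum => j _; rewrite scale_zchar ?irr_vchar ?rpred_int.
have coefP j : exists m : int, '[phi, 'chi_j] = m%:~R.
  exact/Num.Theory.intrP/Cint_cfdot_vchar_irr.
have [z zE] := fin_all_exists coefP.
(* Every irrep occurs in rank 2, so any integer coefficients are allowed. *)
exists z; split=> [j _ |]; first exact: occurs_in_rank2.
by rewrite {1}[phi]cfun_sum_cfdot; apply: eq_bigr => j _; rewrite zE.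
Qed.
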